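(* Let $X_1,X_2,\ldots$ be a sequence of i.i.d. real random variables with probability density in either $\mathcal{P}(1)$ or $\mathcal{P}^+(1)$. Let $r>0$ be fixed. For each $n\ge1$, let $N_n$ be a positive integer and let $f_n$ be a measurable function from $\mathbb{R}^n$ into $\mathbb{R}^{N_n\times N_n}$ (the set of all $N_n\times N_n$ real matrices) such that for all $x_1,\ldots,x_n\in\mathbb{R}$ and all $\lambda\ge0$, $$f_n(\lambda x_1,\ldots,\lambda x_n)=\lambda^r f_n(x_1,\ldots,x_n).$$ Let $M_n:=f_n(X_1,\ldots,X_n)$. Then $\log|\det M_n|$ has fluctuations of order at least $n^{-1/2}N_n$.
   Context: Convention: $\log 0=-\infty$. Class $\mathcal{P}(1)$: the set of all probability densities of the form $e^{-V}$ on $\mathbb{R}$, where $V$ is a $C^\infty$ function, $V$ and all its derivatives have at most polynomial growth at infinity, and $e^{V}$ increases faster than any polynomial at infinity. Class $\mathcal{P}^+(1)$: the set of all probability densities of the form $e^{-V}$ on $[0,\infty)$, such that $V$ is a $C^\infty$ function in $(0,\infty)$, $V$ and all its derivatives have at most polynomial growth at infinity and extend continuously to $0$, and $e^{V}$ increases faster than any polynomial at infinity. Fluctuations: for a sequence of random variables $\{X_n\}$ (possibly taking the value $-\infty$) and a sequence of positive real numbers $\{\delta_n\}$, we say that $X_n$ has fluctuations of order at least $\delta_n$ if there are positive constants $c_1,c_2$ such that for all large $n$, and for all $-\infty<a\le b<\infty$ with $b-a\le c_1\delta_n$, $\mathbb{P}(a\le X_n\le b)\le 1-c_2$. *)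

(* Defs.v *)
From HB Require Import structures.
From mathcomp Require Import all_boot all_order all_algebra finmap.
From mathcomp Require Import all_classical all_reals all_analysis.
Set Implicit Arguments.
Unset Strict Implicit.
Unset Printing Implicit Defensive.
Import Order.TTheory GRing.Theory Num.Theory.
Import numFieldNormedType.Exports.
Local Open Scope classical_set_scope.
Local Open Scope ring_scope.

Section DensityClasses.
Context {R : realType}.
Implicit Types (F : set_system R) (D : set R) (V g p : R -> R).

Definition poly_growth F g : Prop :=
  exists (C : R) (m : nat), \forall x \near F, `|g x| <= C * `|x| ^+ m.

Definition faster_than_polynomials F g : Prop :=
  forall q : {poly R}, q.[x] / g x @[x --> F] --> (0 : R).

(* Meant for open D: at the points of D the derivatives then only depend on
   the values of V on D. *)
Definition smooth_on D V : Prop :=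
  forall (k : nat) (x : R), D x -> derivable (derive1n k V) x 1.

Definition densityP1 p : Prop :=
  exists2 V : R -> R, p = (fun x : R => expR (- V x)) &
    [/\ (\int[lebesgue_measure]_x (p x)%:E = 1)%E,
        smooth_on setT V,
        forall k : nat, poly_growth +oo (derive1n k V) /\
                        poly_growth -oo (derive1n k V) &
        faster_than_polynomials +oo (fun x => expR (V x)) /\
        faster_than_polynomials -oo (fun x => expR (V x))].

(* Densities on [0, +oo[ are extended by 0 to the whole line. Only the values
   of V on [0, +oo[ matter, V 0 being the continuous extension of V to 0. *)
Definition densityP1plus p : Prop :=
  exists2 V : R -> R, p = (fun x : R => expR (- V x)) \_ `[0, +oo[ &
    [/\ (\int[lebesgue_measure]_x (p x)%:E = 1)%E,
        smooth_on `]0, +oo[ V,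
        forall k : nat, poly_growth +oo (derive1n k V),
        V x @[x --> 0^'+] --> V 0 /\
        (forall k : nat, cvg (derive1n k V x @[x --> 0^'+])) &
        faster_than_polynomials +oo (fun x => expR (V x))].

End DensityClasses.

Section RandomVariables.
Context d (T : measurableType d) (R : realType) (P : probability T R).

Definition has_density (X : {RV P >-> R}) (p : R -> R) : Prop :=
  forall A : set R, measurable A ->
    (distribution P X A = \int[lebesgue_measure]_(x in A) (p x)%:E)%E.

Definition mutually_independent (X : nat -> {RV P >-> R}) : Prop :=
  forall (J : {fset nat}) (A : nat -> set R),
    (forall i, measurable (A i)) ->
    (P (\bigcap_(i in [set` J]) (X i @^-1` A i)) =
     \prod_(i <- J) P (X i @^-1` A i))%E.

Definition fluctuations_at_least (Y : nat -> T -> \bar R) (delta : nat -> R) :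
    Prop :=
  exists c1 c2 : R,
    [/\ 0 < c1, 0 < c2 &
      \forall n \near \oo, forall a b : R, a <= b -> b - a <= c1 * delta n ->
        (P [set w | a%:E <= Y n w <= b%:E] <= (1 - c2)%:E)%E].

End RandomVariables.

(* Measurability for the Borel sigma-algebra of the N x N real matrices. *)
Definition borel_measurable_mx {d} {T : measurableType d} {R : realType}
    {N : nat} (f : T -> 'M[R]_N) : Prop :=
  measurable_fun setT (f : T -> g_sigma_algebraType (@open 'M[R]_N)).

(* Main.v *)
Require Import Defs.
From HB Require Import structures.
From mathcomp Require Import all_boot all_order all_algebra finmap.
From mathcomp Require Import all_classical all_reals all_analysis measurable_realfun.
From mathcomp Require Import perm ring lra.
Set Implicit Arguments.
Unset Strict Implicit.
Unset Printing Implicit Defensive.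
Import Order.TTheory GRing.Theory Num.Theory.
Import numFieldNormedType.Exports.
Local Open Scope classical_set_scope.
Local Open Scope ring_scope.

(** Why the fluctuations cannot be smaller.

    Multiply the whole sample by [c = 1 + eta / sqrt n]. Homogeneity turns this
    into a deterministic shift of [log |det M_n|] by [r N_n ln c], which is of
    order [n^(-1/2) N_n]: no event [a <= log |det M_n| <= b] with [b - a] below
    the shift can hold both for the sample and for the dilated sample. Yet the
    two samples cannot be told apart with certainty, their laws having a
    Hellinger affinity bounded below. Hence no such event has probability close
    to 1.

    The affinity is bounded in two steps. In dimension one, let [s] be the
    square root of the density. The curve [c |-> sqrt c * s (c x)] moves at a
    speed at most [B / (1 + x^2)], because [e^V] beats every polynomial while
    [V'] has polynomial growth ([sqrt_density_lipschitz]). This speed is square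
    integrable, so the affinity of the density with its dilation is at least
    [1 - K (c - 1)^2] ([affinity_ge]). For [n] independent coordinates the
    affinities multiply, and [(1 - K eta^2 / n)^n] stays away from 0.

    The product step is carried out without densities in dimension [n]. For
    nonnegative [u] and [w], the bound [sqrt (u (c x) * w x) >= k] for all [x]
    implies [sqrt (E u * E w) >= k * affinity^n]; this is Cauchy-Schwarz in
    dimension one, and it passes to [n] coordinates by integrating them out one
    at a time ([affinity_step], [affinity_tensor]). Applied to functions that
    are small on a set [A] and on its preimage under the dilation, it gives
    [iid_law_disjoint_dilate]: a set disjoint from its preimage under the
    dilation misses at least 1/16 of the mass. *)

(** * Square roots of densities under dilation *)

Section SqrtDensity.
Context {R : realType}.
Implicit Types (V : R -> R) (D : set R) (x y c : R).

(** The function [sqrt c * e^(- V (c x) / 2)], written so that its derivative in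
    [c] is a multiple of itself. *)
Definition scaled_sqrt V x c : R := expR ((ln c - V (c * x)) / 2).

Lemma scaled_sqrtE V x c : 0 < c ->
  scaled_sqrt V x c = Num.sqrt (c * expR (- V (c * x))).
Proof.
move=> c0; apply/esym; rewrite /scaled_sqrt.
have {1}-> : c = expR (ln c) by rewrite lnK.
rewrite -expRD [in LHS](splitr (ln c - _)) expRD -expr2.
by rewrite sqrtr_sqr gtr0_norm ?expR_gt0.
Qed.

(** Half of it bounds [1 + y^2] times the generator of dilations [s / 2 + y s']
    applied to [s = e^(- V / 2)]. *)
Definition weight V y : R :=
  (1 + `|y * derive1 V y|) * (1 + y ^+ 2) * expR (- V y / 2).

Lemma weight_ge0 V y : 0 <= weight V y.
Proof.
rewrite /weight !mulr_ge0 ?expR_ge0 ?addr_ge0 ?sqr_ge0//.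
Qed.

(** Mean value theorem in the dilation parameter. The derivative at [t] is the
    generator of dilations evaluated at [t x], and the decay in [t x] controls
    the decay in [x] since [t >= 1]. *)
Lemma sqrt_density_lipschitz V D (B : R) :
  (forall x c, D x -> 1 <= c -> D (c * x)) ->
  (forall y, D y -> derivable V y 1) ->
  (forall y, D y -> weight V y <= B) ->
  forall x c, D x -> 1 <= c ->
  `|Num.sqrt (expR (- V x)) - Num.sqrt (c * expR (- V (c * x)))|
    <= B * (c - 1) / (1 + x ^+ 2).
Proof.
move=> Dcone dV WB x c Dx c1.
have c0 : 0 < c by lra.
have {1}-> : Num.sqrt (expR (- V x)) = scaled_sqrt V x 1.
  by rewrite scaled_sqrtE// !mul1r.
rewrite -scaled_sqrtE//.
pose dh t := scaled_sqrt V x t * ((t^-1 - x * derive1 V (t * x)) / 2).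
have hd (t : R) : 1 <= t -> is_derive t 1 (scaled_sqrt V x) (dh t).
  move=> t1; have t0 : 0 < t by lra.
  rewrite /scaled_sqrt /dh.
  have dVt : is_derive (t * x) 1 V (derive1 V (t * x)).
    rewrite derive1E; apply: DeriveDef => //; apply: dV; exact: Dcone.
  have dm : is_derive t 1 (fun s : R => s * x) x.
    have -> : (fun s : R => s * x) = (x *: (@id R)).
      by apply/funext => s /=; rewrite mulrC.
    by apply: is_derive_eq; rewrite /GRing.scale/= mulr1.
  have dc : is_derive t 1 (V \o (fun s => s * x)) (x * derive1 V (t * x)).
    by apply: is_derive_eq; rewrite /GRing.scale/= mulrC.
  have dln : is_derive t 1 (@ln R) t^-1 by exact: is_derive1_ln.
  have -> : (fun c0 : R => expR ((ln c0 - V (c0 * x)) / 2)) =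
     expR \o (2^-1 *: (@ln R - (V \o (fun s => s * x)))).
    by apply/funext => s /=; rewrite mulrC.
  have din := is_deriveZ 2^-1 (is_deriveB dln dc).
  have := is_derive1_comp (is_derive_expR _) din.
  rewrite [X in is_derive _ _ _ X -> _](_ : _ =
    scaled_sqrt V x t * ((t^-1 - x * derive1 V (t * x)) / 2)) //.
  rewrite /scaled_sqrt /GRing.scale/= !fctE /GRing.scale/=.
  by congr (expR _ * _); rewrite mulrC.
have [] := @MVT_segment R (scaled_sqrt V x) dh 1 c c1.
- by move=> s /itvP sc; apply: hd; rewrite sc.
- apply: derivable_within_continuous => s /itvP sc.
  by have /hd[] : 1 <= s by rewrite sc.
move=> t /itvP tc; rewrite distrC => ->.
have t1 : 1 <= t by rewrite tc.
have t0 : 0 < t by lra.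
have Dy := Dcone _ _ Dx t1.
rewrite normrM (@ger0_norm _ (c - 1)) ?subr_ge0// mulrAC ler_wpM2r ?subr_ge0//.
have x2 : 0 < 1 + x ^+ 2 by rewrite ltr_pwDl ?sqr_ge0.
rewrite ler_pdivlMr//; apply: le_trans (WB _ Dy).
rewrite /weight /dh normrM (gtr0_norm (expR_gt0 _)) /scaled_sqrt.
rewrite mulrBl expRD -(mulNr (V _)).
set E := expR (_ / 2); set E' := expR (_ / 2).
have E'0 : 0 < E' by exact: expR_gt0.
have E0 : 0 < E by exact: expR_gt0.
(* [E] is the square root of [t], which the factor [1 / t] absorbs. *)
have Et : E <= t.
  rewrite -[leRHS](@lnK _ t)// ler_expR.
  by have := @ln_ge0 R t t1; lra.
set z := t * x * _; set A := `|_|.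
have EA : E * A <= 1 + `|z|.
  have -> : A = t^-1 * `|1 - z| / 2.
    rewrite /A (_ : t^-1 - _ = t^-1 * (1 - z)).
      rewrite !normrM (@gtr0_norm _ t^-1) ?invr_gt0//.
      by rewrite (@gtr0_norm _ 2^-1) ?invr_gt0.
    by rewrite /z mulrBr mulr1 !mulrA mulVf ?gt_eqF// mul1r.
  have nz : `|1 - z| <= 1 + `|z| by rewrite (le_trans (ler_normB _ _))// normr1.
  have Et0 : 0 <= E * t^-1 by rewrite mulr_ge0 ?invr_ge0//; lra.
  have : E * t^-1 * `|1 - z| <= 1 * (1 + `|z|).
    by apply: ler_pM => //; rewrite ler_pdivrMr// mul1r.
  have : 0 <= E * t^-1 * `|1 - z| by rewrite mulr_ge0.
  by rewrite !mulrA; lra.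
have x2t : 1 + x ^+ 2 <= 1 + (t * x) ^+ 2.
  rewrite lerD2l exprMn ler_peMl ?sqr_ge0//.
  by rewrite -(expr1n R 2) lerXn2r ?nnegrE//; lra.
have -> : E * E' * A * (1 + x ^+ 2) = E * A * (1 + x ^+ 2) * E' by ring.
apply: ler_wpM2r; first exact: ltW.
apply: ler_pM => //; last exact: ltW.
by rewrite mulr_ge0 ?normr_ge0 ?ltW.
Qed.

(** The square of the weight is at most a polynomial over [e^V]. *)
Lemma weight_le1_near V (F : set_system R) {FF : Filter F} :
  poly_growth F (derive1 V) ->
  faster_than_polynomials F (fun y => expR (V y)) ->
  \forall y \near F, weight V y <= 1.
Proof.
move=> [C [m VC]] fast.
(* From [(1 + C a)^2 <= 2 + 2 C^2 a^2] with [a = |y|^(m + 1)]; only even powers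
   occur, so that one polynomial serves at both ends of the line. *)
pose q : {poly R} :=
  ((2 : R)%:P + (2 * C ^+ 2)%:P * ('X ^+ 2) ^+ m.+1) * (1 + 'X ^+ 2) ^+ 2.
have qE y : q.[y] = (2 + 2 * C ^+ 2 * (y ^+ 2) ^+ m.+1) * (1 + y ^+ 2) ^+ 2.
  by rewrite /q !hornerE.
have /cvgrPdist_le/(_ 1 ltr01) small := fast q.
near=> y.
have Vy : `|derive1 V y| <= C * `|y| ^+ m by near: y.
have : `|0 - q.[y] / expR (V y)| <= 1 by near: y.
rewrite sub0r normrN => /(le_trans (ler_norm _)) qy.
rewrite -(ler_pXn2r (ltn0Sn 1)) ?nnegrE ?weight_ge0// expr1n.
apply: le_trans qy; rewrite qE /weight !exprMn -expRM_natl.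
have -> : 2 * (- V y / 2) = - V y by field.
rewrite expRN ler_wpM2r ?invr_ge0 ?expR_ge0// ler_wpM2r ?sqr_ge0//.
set a := `|y| ^+ m.+1.
have a0 : 0 <= a by rewrite exprn_ge0.
have -> : y ^+ m.+1 * y ^+ m.+1 = a ^+ 2.
  by rewrite /a -normrX real_normK ?num_real.
have yV : `|y * derive1 V y| <= C * a.
  rewrite normrM /a exprS mulrCA; exact: ler_wpM2l.
have : (1 + `|y * derive1 V y|) ^+ 2 <= (1 + C * a) ^+ 2.
  by rewrite lerXn2r ?nnegrE ?lerD2l// addr_ge0// (le_trans _ yV).
move/le_trans; apply.
have := sqr_ge0 (1 - C * a).
by rewrite !expr2; nra.
Unshelve. all: by end_near. Qed.

Lemma weight_continuous V y : derivable V y 1 -> derivable (derive1 V) y 1 ->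
  {for y, continuous (weight V)}.
Proof.
move=> /derivable1_diffP/differentiable_continuous cV.
move=> /derivable1_diffP/differentiable_continuous cV'.
rewrite /weight; apply: cvgM; first apply: cvgM.
- apply: cvgD; first exact: cvg_cst.
  by apply: cvg_norm; apply: cvgM => //; exact: cvg_id.
- by apply: cvgD; [exact: cvg_cst|exact: exprn_continuous].
apply: (@continuous_comp _ _ _ (fun y => - V y / 2) (@expR R)).
  by apply: cvgM; [exact: cvgN|exact: cvg_cst].
exact: continuous_expR.
Qed.

Lemma weight_bounded_segment V a b :
  (forall y, a <= y <= b -> derivable V y 1 /\ derivable (derive1 V) y 1) ->
  exists B, forall y, a <= y <= b -> weight V y <= B.
Proof.
move=> dV; have [ab|ba] := leP a b; last first.
  by exists 0 => y /andP[ay yb]; lra.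
have [] := @EVT_max R (weight V) a b ab.
  apply: continuous_in_subspaceT => y; rewrite inE/= in_itv/= => /dV[? ?].
  exact: weight_continuous.
move=> c _ cmax; exists (weight V c) => y yab.
by apply: cmax; rewrite in_itv.
Qed.

Lemma weight_bounded_nbhs0_right V :
  V x @[x --> 0^'+] --> V 0 -> cvg (derive1 V x @[x --> 0^'+]) ->
  exists2 e : R, 0 < e & exists B, forall y, 0 < y -> y < e -> weight V y <= B.
Proof.
move=> cV cV'.
have cw : cvg (weight V x @[x --> (0 : R)^'+]).
  apply: is_cvgM; first apply: is_cvgM.
  - apply: is_cvgD; first exact: is_cvg_cst.
    apply: is_cvg_norm; apply: is_cvgM => //.
    by apply/cvg_ex; exists 0; exact/cvg_at_right_filter/cvg_id.
  - apply/cvg_ex; exists (1 + 0 ^+ 2); apply: cvg_at_right_filter.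
    by apply: cvgD; [exact: cvg_cst|exact: exprn_continuous].
  apply/cvg_ex; exists (expR (- V 0 / 2)).
  have h : - V x / 2 @[x --> (0 : R)^'+] --> - V 0 / 2.
    by apply: cvgM; [exact: cvgN|exact: cvg_cst].
  exact: (cvg_comp _ _ h (@continuous_expR R _)).
move/cvgrPdist_le : cw => /(_ 1 ltr01).
rewrite near_withinE => /nbhs_ballP[e /= e0 eB].
exists e => //; exists (1 + `|lim (weight V x @[x --> (0 : R)^'+])|).
move=> y y0 ye; set l := lim _.
have : `|l - weight V y| <= 1.
  apply: eB => //; rewrite /ball/= sub0r normrN gtr0_norm//.
have := ler_distD l (weight V y) 0; rewrite !subr0 distrC.
have := ler_norm (weight V y); lra.
Qed.

Lemma densityP1_sqrt_lipschitz (p : R -> R) : densityP1 p ->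
  exists B : R, forall x c, 1 <= c ->
  `|Num.sqrt (p x) - Num.sqrt (c * p (c * x))| <= B * (c - 1) / (1 + x ^+ 2).
Proof.
move=> [V -> [_ smoothV growth [fastp fastm]]].
have [V'p V'm] := growth 1%N.
have [[M1 [_ Mp]] [M2 [_ Mm]]] :=
  (weight_le1_near V'p fastp, weight_le1_near V'm fastm).
have [B WB] := @weight_bounded_segment V M2 M1
  (fun y _ => conj (smoothV 0%N y I) (smoothV 1%N y I)).
exists (Num.max 1 B) => x c c1; apply: (@sqrt_density_lipschitz V setT) => // [y _|y _].
  exact: (smoothV 0%N).
rewrite le_max; have [yM1|yM1] := leP y M1; last by rewrite Mp.
by have [yM2|yM2] := leP M2 y; [rewrite WB ?yM2 ?orbT|rewrite Mm].
Qed.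

(** The half-line is stable under dilations, so that only the origin needs a
    separate bound. *)
Lemma densityP1plus_sqrt_lipschitz (p : R -> R) : densityP1plus p ->
  exists B : R, forall x c, 1 <= c ->
  `|Num.sqrt (p x) - Num.sqrt (c * p (c * x))| <= B * (c - 1) / (1 + x ^+ 2).
Proof.
move=> [V -> [_ smoothV growth [cV cV'] fast]].
have [M1 [_ Mp]] := weight_le1_near (growth 1%N) fast.
have [e e0 [B0 WB0]] := weight_bounded_nbhs0_right cV (cV' 1%N).
have [B WB] : exists B, forall y, e <= y <= M1 -> weight V y <= B.
  apply: weight_bounded_segment => y /andP[ey _].
  have y0 : y \in `]0, +oo[ by rewrite in_itv/= andbT; lra.
  exact: (conj (smoothV 0%N y y0) (smoothV 1%N y y0)).
(* At [x = 0] the dilation only acts by the factor [sqrt c], hence the first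
   term of the maximum. *)
pose B' := Num.max (Num.sqrt (expR (- V 0))) (Num.max 1 (Num.max B B0)).
have B'0 : 0 <= B' by rewrite le_max sqrtr_ge0.
exists B' => x c c1; have c0 : 0 < c by lra.
rewrite /patch !mem_setE !in_itv/= !andbT pmulr_rge0//.
have x2 : 0 < 1 + x ^+ 2 by rewrite ltr_pwDl ?sqr_ge0.
case: ifPn => [|_]; last first.
  by rewrite mulr0 subrr normr0 !mulr_ge0 ?invr_ge0 ?(ltW x2)//; lra.
rewrite le_eqVlt => /predU1P[<-|x0].
  rewrite mulr0 expr0n/= addr0 divr1 sqrtrM; last exact: ltW.
  set s := Num.sqrt (expR _).
  have s0 : 0 <= s by exact: sqrtr_ge0.
  have sc : Num.sqrt c <= c.
    rewrite -(ler_pXn2r (ltn0Sn 1)) ?nnegrE ?sqrtr_ge0 ?(ltW c0)//.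
    by rewrite sqr_sqrtr ?(ltW c0)// expr2 ler_peMl ?(ltW c0).
  have sc1 : 1 <= Num.sqrt c by rewrite -[leLHS]sqrtr1 ler_sqrt ?(ltW c0).
  have sB : s <= B' by rewrite le_max lexx.
  rewrite distrC ger0_norm; nra.
apply: (@sqrt_density_lipschitz V `]0, +oo[) => //.
- by move=> y t; rewrite /= !in_itv/= !andbT => y0 t1; nra.
- exact: (smoothV 0%N).
- move=> y; rewrite /= in_itv/= andbT => y0; rewrite !le_max.
  have [yM1|yM1] := leP y M1; last by rewrite Mp ?orbT.
  have [ye|ey] := ltP y e; first by rewrite WB0 ?orbT.
  by rewrite WB ?ey ?orbT.
- by rewrite /= in_itv/= x0.
Qed.

Lemma densityP1_measurable (p : R -> R) : densityP1 p -> measurable_fun setT p.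
Proof.
move=> [V -> [_ smoothV _ _]].
apply: continuous_measurable_fun => x.
apply: (@continuous_comp _ _ _ (fun y => - V y) (@expR R)).
  apply: cvgN; apply/differentiable_continuous/derivable1_diffP.
  exact: (smoothV 0%N).
exact: continuous_expR.
Qed.

Lemma densityP1plus_measurable (p : R -> R) :
  densityP1plus p -> measurable_fun setT p.
Proof.
move=> [V -> [_ smoothV _ _ _]].
apply/(measurable_restrictT _ _).1; first exact: measurable_itv.
rewrite -(@setU1itv _ _ _ _ false)//; apply/measurable_funU => //; split.
  exact: measurable_fun_set1.
apply: open_continuous_measurable_fun; first exact: interval_open.
move=> x; rewrite inE/= => x0.
apply: (@continuous_comp _ _ _ (fun y => - V y) (@expR R)).
  apply: cvgN; apply/differentiable_continuous/derivable1_diffP.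
  exact: (smoothV 0%N).
exact: continuous_expR.
Qed.

Lemma density_facts (p : R -> R) : densityP1 p \/ densityP1plus p ->
  [/\ measurable_fun setT p, forall x, 0 <= p x,
      (\int[lebesgue_measure]_x (p x)%:E = 1)%E &
      exists B : R, forall x c, 1 <= c ->
      `|Num.sqrt (p x) - Num.sqrt (c * p (c * x))|
        <= B * (c - 1) / (1 + x ^+ 2)].
Proof.
move=> [] hp; split.
- exact: densityP1_measurable.
- by case: hp => V -> _ x; exact: expR_ge0.
- by case: hp => V _ [].
- exact: densityP1_sqrt_lipschitz.
- exact: densityP1plus_measurable.
- by case: hp => V -> _ x; rewrite patchE; case: ifPn => // _; exact: expR_ge0.
- by case: hp => V _ [].
- exact: densityP1plus_sqrt_lipschitz.
Qed.

End SqrtDensity.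

(** * Integration against a density and under dilations *)

Section Integrals.
Context {R : realType}.
Local Open Scope ereal_scope.
Local Notation leb := (@lebesgue_measure R).

(** The function [p] is almost everywhere the Radon-Nikodym derivative. *)
Lemma ge0_integral_density d (T : measurableType d)
    (nu : {finite_measure set T -> \bar R})
    (mu : {sigma_finite_measure set T -> \bar R}) (p : T -> R) :
  measurable_fun setT p -> (forall x, 0 <= p x)%R ->
  (forall A, measurable A -> nu A = \int[mu]_(x in A) (p x)%:E) ->
  forall f : T -> \bar R, measurable_fun setT f -> (forall x, 0 <= f x) ->
  \int[nu]_x f x = \int[mu]_x (f x * (p x)%:E).
Proof.
move=> mp p0 nuE f mf f0.
have mpE : measurable_fun setT (EFin \o p) by exact/measurable_EFinP.
have numu : nu `<< mu.
  apply/null_content_dominatesP => A mA muA0.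
  by rewrite nuE// null_set_integral//; exact: measurable_funTS.
have RNfin := Radon_Nikodym_SigmaFinite.f_integrable numu.
rewrite -(Radon_Nikodym_SigmaFinite.change_of_variables numu f0 measurableT mf).
have RN0 := Radon_Nikodym_SigmaFinite.f_ge0 numu.
have mRN := measurable_int _ RNfin.
apply: ge0_ae_eq_integral => //.
- exact: emeasurable_funM.
- exact: emeasurable_funM.
- by move=> x _; rewrite mule_ge0.
- by move=> x _; rewrite mule_ge0// lee_fin.
apply: (ae_eq_comp2 (fun x y => f x * y)); apply: integral_ae_eq => //.
move=> A _ mA; rewrite -nuE//.
by rewrite -Radon_Nikodym_SigmaFinite.f_integral.
Qed.

(** The law lives on the Borel sigma-algebra attached to [R], the Lebesgue
    measure on the one attached to [measurableTypeR R]; the identity transports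
    the law from the former to the latter. *)
Lemma ge0_integral_lebesgue_density (nu : probability R R) (p : R -> R) :
  measurable_fun setT p -> (forall x, 0 <= p x)%R ->
  (forall A, measurable A -> nu A = \int[leb]_(x in A) (p x)%:E) ->
  forall f : R -> \bar R, measurable_fun setT f -> (forall x, 0 <= f x) ->
  \int[nu]_x f x = \int[leb]_x (f x * (p x)%:E).
Proof.
move=> mp p0 nuE f mf f0.
pose toB (x : R) : measurableTypeR R := x.
have mtoB : measurable_fun setT toB by move=> _ A mA; rewrite setTI; exact: mA.
pose toB_mfun : {mfun R >-> measurableTypeR R} :=
  HB.pack toB (isMeasurableFun.Build _ _ _ _ toB mtoB).
rewrite -(@ge0_integral_density _ _ (distribution nu toB_mfun) leb p mp p0)//.
by rewrite ge0_integral_distribution.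
Qed.

Lemma ge0_integral_dilation (c : R) (f : R -> \bar R) : (0 < c)%R ->
  measurable_fun setT f -> (forall x, 0 <= f x) ->
  \int[leb]_x f x = c%:E * \int[leb]_x f (c * x)%R.
Proof.
move=> c0 mf f0.
pose dil (x : measurableTypeR R) : measurableTypeR R := (c * x)%R.
have mdil : measurable_fun setT dil by exact: measurable_funM.
have -> : \int[leb]_x f (c * x)%R = \int[pushforward leb dil]_x f x.
  by rewrite ge0_integral_pushforward.
rewrite -[c]/((NngNum (ltW c0))%:num) -ge0_integral_mscale//.
apply: eq_measure_integral => A mA _.
apply: lebesgue_measure_unique => //= _ [[a b]] _ <-.
rewrite /mscale/= /pushforward.
rewrite (_ : _ @^-1` _ = `](a / c)%R, (b / c)%R]%classic); last first.
  apply/seteqP; split => x /=; rewrite !in_itv/= ltr_pdivrMr// ler_pdivlMr//;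
  by rewrite mulrC.
rewrite !lebesgue_measure_itv/= !lte_fin ltr_pM2r ?invr_gt0//.
case: ifPn => _; last by rewrite mule0.
by rewrite -!EFinB -EFinM -mulrBl mulrCA mulfV ?gt_eqF// mulr1.
Qed.

Lemma integral_oneDsqrV : \int[leb]_x ((1 + x ^+ 2)^-1)%:E = pi%:E.
Proof.
have := @integral0y_oneDsqr R; rewrite /oneDsqr => h.
rewrite (@ge0_symfun_integralT R (fun x => (1 + x ^+ 2)^-1)%R)/=.
- by rewrite -set_itvcy h -EFinM; congr EFin; field.
- by move=> x; rewrite invr_ge0 addr_ge0// sqr_ge0.
- exact: (@continuous_oneDsqrV R).
- by move=> x /=; rewrite sqrrN.
Qed.

End Integrals.

(** * The Hellinger affinity of a density and its dilation *)

Section Affinity.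
Context {R : realType}.
Local Open Scope ereal_scope.
Local Notation leb := (@lebesgue_measure R).
Implicit Types (p : R -> R) (c : R).

(** The integral of the geometric mean of [p] and of [x |-> c * p (c * x)], the
    density of [X / c] when [X] has density [p]. *)
Definition affinity p c : \bar R :=
  \int[leb]_x (Num.sqrt (p x) * Num.sqrt (c * p (c * x)))%:E.

Lemma measurable_sqrt_density p c : measurable_fun setT p ->
  measurable_fun setT (fun x => Num.sqrt (c * p (c * x)))%R.
Proof.
move=> mp.
apply: (measurableT_comp (continuous_measurable_fun (@sqrt_continuous R))).
apply: measurable_funM => //.
by apply: (measurableT_comp mp); exact: measurable_funM.
Qed.

(** Twice the affinity is 2 minus the squared Hellinger distance, which the
    pointwise bound makes quadratic in [c - 1]. *)
Lemma affinity_ge p (B c : R) : measurable_fun setT p ->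
  (forall x, 0 <= p x)%R -> \int[leb]_x (p x)%:E = 1 -> (1 <= c)%R ->
  (forall x, `|Num.sqrt (p x) - Num.sqrt (c * p (c * x))|
     <= B * (c - 1) / (1 + x ^+ 2))%R ->
  (1 - B ^+ 2 * pi / 2 * (c - 1) ^+ 2)%:E <= affinity p c.
Proof.
move=> mp p0 p1 c1 lip; have c0 : (0 < c)%R by lra.
pose s x : R := Num.sqrt (p x); pose t x : R := Num.sqrt (c * p (c * x))%R.
have ms : measurable_fun setT s.
  exact: (measurableT_comp (continuous_measurable_fun (@sqrt_continuous R))).
have mt : measurable_fun setT t by exact: measurable_sqrt_density.
have st0 x : (0 <= s x * t x)%R by rewrite mulr_ge0 ?sqrtr_ge0.
have pE x : (s x ^+ 2 = p x)%R by rewrite sqr_sqrtr.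
have cpE x : (t x ^+ 2 = c * p (c * x))%R.
  by rewrite sqr_sqrtr// mulr_ge0// ltW.
have int_t : \int[leb]_x (c * p (c * x))%:E = 1.
  under eq_integral do rewrite EFinM.
  rewrite ge0_integralZl_EFin; last 4 first.
  - by [].
  - by move=> x _; rewrite lee_fin.
  - apply/measurable_EFinP/(measurableT_comp mp); exact: measurable_funM.
  - by rewrite ltW.
  rewrite -(@ge0_integral_dilation R c (EFin \o p))//.
  exact/measurable_EFinP.
have two : 2%:E = \int[leb]_x ((s x - t x) ^+ 2)%:E + 2%:E * affinity p c.
  rewrite /affinity -ge0_integralZl_EFin; last 4 first.
  - by [].
  - by move=> x _; rewrite lee_fin.
  - exact/measurable_EFinP/measurable_funM.
  - by [].
  rewrite -ge0_integralD; last 5 first.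
  - by [].
  - by move=> x _; rewrite lee_fin sqr_ge0.
  - exact/measurable_EFinP/measurable_funX/measurable_funB.
  - by move=> x _; rewrite mule_ge0// lee_fin.
  - exact/measurable_funeM/measurable_EFinP/measurable_funM.
  transitivity (\int[leb]_x (p x)%:E + \int[leb]_x (c * p (c * x))%:E).
    by rewrite int_t p1.
  rewrite -ge0_integralD; last 5 first.
  - by [].
  - by move=> x _; rewrite lee_fin.
  - exact/measurable_EFinP.
  - by move=> x _; rewrite lee_fin mulr_ge0// ltW.
  - apply/measurable_EFinP/measurable_funM => //.
    by apply: (measurableT_comp mp); exact: measurable_funM.
  apply: eq_integral => x _; rewrite -EFinM -!EFinD; congr EFin.
  by rewrite -/(s x) -/(t x) -cpE -pE; ring.
have mq : measurable_fun setT (fun x : R => (1 + x ^+ 2)^-1)%R.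
  by apply: continuous_measurable_fun; exact: continuous_oneDsqrV.
have small : \int[leb]_x ((s x - t x) ^+ 2)%:E <=
    ((B * (c - 1)) ^+ 2 * pi)%:E.
  rewrite EFinM -integral_oneDsqrV -ge0_integralZl_EFin; last 4 first.
  - by [].
  - by move=> x _; rewrite lee_fin invr_ge0 addr_ge0// sqr_ge0.
  - exact/measurable_EFinP.
  - exact: sqr_ge0.
  apply: ge0_le_integral => //.
  - by move=> x _; rewrite lee_fin sqr_ge0.
  - exact/measurable_EFinP/measurable_funX/measurable_funB.
  - exact/measurable_funeM/measurable_EFinP.
  move=> x _; rewrite -EFinM lee_fin.
  have x1 : (1 <= 1 + x ^+ 2)%R by rewrite lerDl sqr_ge0.
  rewrite -real_normK ?num_real//.
  apply: (@le_trans _ _ ((B * (c - 1) / (1 + x ^+ 2)) ^+ 2)%R).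
    by rewrite lerXn2r ?nnegrE// (le_trans _ (lip x)).
  rewrite exprMn ler_wpM2l ?sqr_ge0// expr2 ger_pMl ?invr_gt0//; last by lra.
  by rewrite invf_le1//; lra.
have aff0 : 0 <= affinity p c.
  by apply: integral_ge0 => x _; rewrite lee_fin.
move: small two aff0; case: (affinity p c) => [a| |]; rewrite ?leey//.
case: (\int[leb]_x _) => [b| |]// + [] + _.
by rewrite !lee_fin exprMn; nra.
Qed.

(** The condition quantified over [a] says that [sqrt (u w) >= k]: by the
    arithmetic-geometric inequality [2 sqrt (u w)] is the infimum of
    [a u + w / a]. Unlike the square root, this form is linear in [u] and [w], so
    that it can be integrated, and it makes sense for infinite values. *)
Lemma scaled_AMGM_pointwise (k s t al : R) (u w : \bar R) :
  (0 <= s)%R -> (0 <= t)%R -> (0 < al)%R -> 0 <= u -> 0 <= w ->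
  (forall a : R, (0 < a)%R -> (2 * k)%:E <= a%:E * u + a^-1%:E * w) ->
  (2 * k * (s * t))%:E <= al%:E * (u * (t ^+ 2)%:E) + al^-1%:E * (w * (s ^+ 2)%:E).
Proof.
move=> s0 t0 al0 u0 w0 uw.
have rhs0 : 0 <= al%:E * (u * (t ^+ 2)%:E) + al^-1%:E * (w * (s ^+ 2)%:E).
  rewrite adde_ge0// mule_ge0 ?mule_ge0 ?lee_fin ?sqr_ge0 ?invr_ge0 ?(ltW al0)//.
have [s_eq0|s_neq0] := eqVneq s 0%R; first by rewrite {1}s_eq0 mul0r mulr0.
have [t_eq0|t_neq0] := eqVneq t 0%R; first by rewrite {1}t_eq0 !mulr0.
have sp : (0 < s)%R by rewrite lt_neqAle eq_sym s_neq0.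
have tp : (0 < t)%R by rewrite lt_neqAle eq_sym t_neq0.
(* The weights [s] and [t] are absorbed into the free parameter. *)
have a0 : (0 < al * t / s)%R by rewrite divr_gt0// mulr_gt0.
have /(lee_wpmul2l (_ : 0 <= (s * t)%:E)) := uw _ a0.
rewrite lee_fin mulr_ge0// => /(_ isT).
rewrite -EFinM mulrC => /le_trans; apply.
rewrite muleDr//; last by apply: ge0_adde_def; rewrite inE mule_ge0// lee_fin ?invr_ge0 ltW.
rewrite (muleC u) (muleC w) !muleA -!EFinM.
rewrite le_eqVlt; apply/orP; left; apply/eqP.
by congr (_%:E * _ + _%:E * _); field; rewrite ?s_neq0 ?t_neq0 ?gt_eqF.
Qed.

(** The Cauchy-Schwarz inequality: if [sqrt (u (c x) * w x) >= k] everywhere, then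
    [sqrt (E u * E w) >= k * affinity], both sides being in the parametric form
    of [scaled_AMGM_pointwise]. *)
Lemma affinity_step p (c k : R) (u w : R -> \bar R) : measurable_fun setT p ->
  (forall x, 0 <= p x)%R -> (0 < c)%R -> (0 <= k)%R ->
  measurable_fun setT u -> (forall x, 0 <= u x) ->
  measurable_fun setT w -> (forall x, 0 <= w x) ->
  (forall x (a : R), (0 < a)%R ->
     (2 * k)%:E <= a%:E * u (c * x)%R + a^-1%:E * w x) ->
  forall al : R, (0 < al)%R -> (2 * k)%:E * affinity p c <=
    al%:E * (\int[leb]_x (u x * (p x)%:E)) +
    al^-1%:E * (\int[leb]_x (w x * (p x)%:E)).
Proof.
move=> mp p0 c0 k0 mu u0 mw w0 uw al al0.
have al0' : (0 <= al)%R by exact: ltW.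
have alV0 : (0 <= al^-1)%R by rewrite invr_ge0.
have mpE : measurable_fun setT (EFin \o p) by exact/measurable_EFinP.
have mc : measurable_fun setT (fun x : R => c * x)%R by exact: measurable_funM.
have mup : measurable_fun setT (fun x => u x * (p x)%:E) by exact: emeasurable_funM.
have mwp : measurable_fun setT (fun x => w x * (p x)%:E) by exact: emeasurable_funM.
have mupc : measurable_fun setT (fun x => u (c * x)%R * (c * p (c * x))%:E).
  apply: emeasurable_funM; first exact: measurableT_comp.
  apply/measurable_EFinP/measurable_funM => //; exact: (measurableT_comp mp).
have up0 x : 0 <= u x * (p x)%:E by rewrite mule_ge0// lee_fin.
have wp0 x : 0 <= w x * (p x)%:E by rewrite mule_ge0// lee_fin.
have upc0 x : 0 <= u (c * x)%R * (c * p (c * x))%:E.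
  by rewrite mule_ge0// lee_fin mulr_ge0// ltW.
have st0 x : 0 <= (Num.sqrt (p x) * Num.sqrt (c * p (c * x)))%:E.
  by rewrite lee_fin mulr_ge0// sqrtr_ge0.
have mst : measurable_fun setT
    (fun x => (Num.sqrt (p x) * Num.sqrt (c * p (c * x)))%:E).
  apply/measurable_EFinP/measurable_funM; last exact: measurable_sqrt_density.
  exact: (measurableT_comp (continuous_measurable_fun (@sqrt_continuous R))).
have -> : \int[leb]_x (u x * (p x)%:E) =
    \int[leb]_x (u (c * x)%R * (c * p (c * x))%:E).
  rewrite (ge0_integral_dilation c0)// -ge0_integralZl_EFin//; first last.
  - exact: ltW.
  - exact: (measurableT_comp mup mc).
  by apply: eq_integral => x _; rewrite EFinM muleCA.
rewrite /affinity -!ge0_integralZl_EFin//; last by rewrite mulr_ge0.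
rewrite -ge0_integralD; last 5 first.
- by [].
- by move=> x _; rewrite mule_ge0// lee_fin.
- exact: measurable_funeM.
- by move=> x _; rewrite mule_ge0// lee_fin.
- exact: measurable_funeM.
apply: ge0_le_integral => //.
- by move=> x _; rewrite mule_ge0// lee_fin mulr_ge0.
- exact: measurable_funeM.
- by apply: emeasurable_funD; exact: measurable_funeM.
move=> x _; rewrite -EFinM.
have := @scaled_AMGM_pointwise k (Num.sqrt (p x)) (Num.sqrt (c * p (c * x))%R) al
  (u (c * x)%R) (w x) (sqrtr_ge0 _) (sqrtr_ge0 _) al0 (u0 _) (w0 _) (uw x).
by rewrite !sqr_sqrtr// mulr_ge0// ltW.
Qed.

End Affinity.

(** * Product laws on tuples *)

Section IidLaw.
Context {R : realType}.
Local Open Scope ereal_scope.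

Definition box n (A : 'I_n -> set R) : set (n.-tuple R) :=
  [set t | forall i, A i (tnth t i)].

Definition iid_law (mu : probability R R) n (Q : probability (n.-tuple R) R) :=
  forall A : 'I_n -> set R, (forall i, measurable (A i)) ->
  Q (box A) = \prod_(i < n) mu (A i).

Lemma measurable_box n (A : 'I_n -> set R) :
  (forall i, measurable (A i)) -> measurable (box A).
Proof.
move=> mA.
rewrite (_ : box A = \bigcap_(i in [set: 'I_n]) ((@tnth n R)^~ i @^-1` A i)).
  apply: fin_bigcap_measurable => [|i _]; first exact: finite_finset.
  by rewrite -[X in measurable X]setTI; apply: measurable_tnth.
by apply/seteqP; split => [t At i _|t At i]; [exact: At|exact: (At i)].
Qed.

Lemma measurable_tuple_boxes n : @measurable _ (n.-tuple R) =
  <<s [set B | exists2 A : 'I_n -> set R,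
         (forall i, measurable (A i)) & B = box A] >>.
Proof.
rewrite eqEsubset; split.
  apply: smallest_sub; first exact: smallest_sigma_algebra.
  move=> B; rewrite -bigcup_seq => -[i _ [A mA <-]].
  apply: sub_sigma_algebra; exists (fun j => if j == i then A else setT).
    by move=> j; case: ifPn.
  apply/seteqP; split => [t [_ At] j|t /(_ i)] /=; last by rewrite eqxx.
  by case: eqVneq => [->|].
apply: smallest_sub; first exact: sigma_algebra_measurable.
by move=> _ [A mA ->]; exact: measurable_box.
Qed.

Lemma measure_tuple_unique n (m1 m2 : {measure set (n.-tuple R) -> \bar R}) :
  m1 setT < +oo ->
  (forall A : 'I_n -> set R, (forall i, measurable (A i)) ->
     m1 (box A) = m2 (box A)) ->
  forall B, measurable B -> m1 B = m2 B.
Proof.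
move=> m1oo m12.
have boxT : setT = @box n (fun=> setT) by apply/seteqP; split.
apply: (measure_unique _ (fun=> setT) (measurable_tuple_boxes n)) => //.
- move=> _ _ [A mA ->] [B mB ->]; exists (fun i => A i `&` B i).
    by move=> i; exact: measurableI.
  apply/seteqP; split => [t [At Bt] i|t ABt]; first by split; [exact: At|exact: Bt].
  by split => i; case: (ABt i).
- by move=> _; exists (fun=> setT).
- by rewrite bigcup_const.
- by move=> _ [A mA ->]; exact: m12.
Qed.

(** Boxes generate the sigma-algebra and are stable under intersection, so [Q] is
    the image of a product measure, to which Tonelli's theorem applies. *)
Lemma iid_law_disintegration (mu : probability R R) n
    (Q : probability (n.+1.-tuple R) R) : iid_law mu Q ->
  exists2 Q' : probability (n.-tuple R) R, iid_law mu Q' &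
    forall u : n.+1.-tuple R -> \bar R,
    measurable_fun setT u -> (forall t, 0 <= u t) ->
    \int[Q]_t u t = \int[mu]_x \int[Q']_t u [tuple of x :: t].
Proof.
move=> Qmu.
pose tail (t : n.+1.-tuple R) : n.-tuple R := [tuple of behead t].
pose tail_mfun : {mfun (n.+1.-tuple R) >-> (n.-tuple R)} :=
  HB.pack tail (isMeasurableFun.Build _ _ _ _ tail (@measurable_behead _ R n)).
pose Q' : probability (n.-tuple R) R := distribution Q tail_mfun.
have Q'E (x : set R) (A : 'I_n -> set R) : measurable x ->
    (forall i, measurable (A i)) ->
  Q [set t | x (tnth t ord0) /\ box A (tail t)] = mu x * \prod_(i < n) mu (A i).
  move=> mx mA.
  pose A' i := oapp A x (unlift ord0 i).
  have -> : [set t | x (tnth t ord0) /\ box A (tail t)] = box A'.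
    apply/seteqP; split => t /=.
      move=> [xt At] i; rewrite /A'; case: unliftP => [j ->|->]//=.
      by rewrite (tuple_eta t) tnthS; exact: At.
    move=> At; split; first by have := At ord0; rewrite /A' unlift_none.
    move=> i; have := At (lift ord0 i); rewrite /A' liftK/=.
    by rewrite [X in tnth X](tuple_eta t) tnthS.
  rewrite Qmu => [|i]; last by rewrite /A'; case: unliftP => [j _|_] //=.
  rewrite big_ord_recl {1}/A' unlift_none/=; congr (_ * _).
  by apply: eq_bigr => i _; rewrite /A' liftK.
have Q'mu : iid_law mu Q'.
  move=> A mA; have := Q'E setT A measurableT mA.
  rewrite probability_setT mul1e => <-.
  by rewrite /Q' /distribution/= /pushforward; congr (Q _); apply/seteqP; split => t //= [].
exists Q' => // u mu_ u0.
pose glue (z : R * n.-tuple R) : n.+1.-tuple R := [tuple of z.1 :: z.2].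
have mglue : measurable_fun setT glue by exact: measurable_cons.
transitivity (\int[pushforward (mu \x Q') glue]_t u t).
  apply: eq_measure_integral => B mB _.
  apply: measure_tuple_unique => //.
    by rewrite [ltLHS]probability_setT ltry.
  move=> A mA; apply: (eq_trans (Qmu _ mA)).
  transitivity ((mu \x Q') (glue @^-1` box A)) => //.
  have -> : glue @^-1` box A = A ord0 `*` box (fun i => A (lift ord0 i)).
    apply/seteqP; split => [[x t] /= At|[x t] /= [Ax At] i].
      split => [|i] /=; first by have := At ord0; rewrite tnth0.
      by have := At (lift ord0 i); rewrite tnthS.
    by case: (unliftP ord0 i) => [j ->|->]; rewrite ?tnthS ?tnth0//; exact: At.
  rewrite product_measure1E//; last exact: measurable_box.
  rewrite big_ord_recl; congr (_ * _).
  by apply/esym/Q'mu => i; exact: mA.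
rewrite ge0_integral_pushforward//= fubini_tonelli1//=.
exact: (measurableT_comp mu_ mglue).
Qed.

Definition dilate n (c : R) (x : n.-tuple R) : n.-tuple R :=
  [tuple (c * tnth x i)%R | i < n].

Lemma dilate_cons n c x (t : n.-tuple R) :
  dilate c [tuple of x :: t] = [tuple of (c * x)%R :: dilate c t].
Proof.
apply: eq_from_tnth => i; rewrite tnth_mktuple.
by case: (unliftP ord0 i) => [j ->|->]; rewrite ?tnthS ?tnth0 ?tnth_mktuple.
Qed.

(** The class of pairs [(u, w)] with [sqrt (u (c t) * w t) >= k] is stable under
    integration of the last coordinates, with [k] replaced by [k * rho ^+ n];
    [affinity_step] then deals with the first coordinate. *)
Lemma affinity_tensor (mu : probability R R) (p : R -> R) (c rho : R) :
  measurable_fun setT p -> (forall x, 0 <= p x)%R ->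
  (forall A, measurable A ->
     mu A = \int[@lebesgue_measure R]_(x in A) (p x)%:E) ->
  (0 < c)%R -> (0 <= rho)%R -> rho%:E <= affinity p c ->
  forall n (Q : probability (n.-tuple R) R), iid_law mu Q ->
  forall (k : R) (u w : n.-tuple R -> \bar R), (0 <= k)%R ->
  measurable_fun setT u -> (forall t, 0 <= u t) ->
  measurable_fun setT w -> (forall t, 0 <= w t) ->
  (forall t (a : R), (0 < a)%R ->
     (2 * k)%:E <= a%:E * u (dilate c t) + a^-1%:E * w t) ->
  forall a : R, (0 < a)%R ->
    (2 * (k * rho ^+ n))%:E <= a%:E * \int[Q]_t u t + a^-1%:E * \int[Q]_t w t.
Proof.
move=> mp p0 mup c0 rho0 rhoc; elim=> [|n IH] Q Qmu k u w k0 mu_ u0 mw w0 uw a a0.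
  have int0 (v : 0.-tuple R -> \bar R) : \int[Q]_t v t = v [tuple].
    rewrite (eq_integral (cst (v [tuple]))) => [|t _]; last by rewrite tuple0.
    by rewrite integral_cst// -[RHS]mule1 [X in _ * X]probability_setT.
  rewrite expr0 mulr1 !int0.
  by have := uw [tuple] a a0; rewrite (tuple0 (dilate _ _)).
have [Q' Q'mu intQ] := iid_law_disintegration Qmu.
rewrite !intQ//.
have mcons : measurable_fun setT
    (fun z : R * n.-tuple R => [tuple of z.1 :: z.2] : n.+1.-tuple R).
  exact: measurable_cons.
have mu' : measurable_fun setT (fun z : R * n.-tuple R => u [tuple of z.1 :: z.2]).
  exact: (measurableT_comp mu_ mcons).
have mw' : measurable_fun setT (fun z : R * n.-tuple R => w [tuple of z.1 :: z.2]).
  exact: (measurableT_comp mw mcons).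
have mU := @measurable_fun_fubini_tonelli_F _ _ _ _ _ Q' _ mu' (fun=> u0 _).
have mW := @measurable_fun_fubini_tonelli_F _ _ _ _ _ Q' _ mw' (fun=> w0 _).
rewrite /fubini_F/= in mU mW.
set U := (fun x : R => \int[Q']_t u _) in mU *.
set W := (fun x : R => \int[Q']_t w _) in mW *.
have U0 x : 0 <= U x by exact: integral_ge0.
have W0 x : 0 <= W x by exact: integral_ge0.
rewrite !(ge0_integral_lebesgue_density mp p0 mup)//.
have kn0 : (0 <= k * rho ^+ n)%R by rewrite mulr_ge0// exprn_ge0.
apply: (le_trans _ (affinity_step mp p0 c0 kn0 mU U0 mW W0 _ a0)).
  rewrite exprSr !mulrA EFinM; apply: lee_wpmul2l => //.
  by rewrite lee_fin -mulrA mulr_ge0.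
move=> x b b0; apply: IH => //.
- exact: (measurableT_comp mu' (pair1_measurable _)).
- exact: (measurableT_comp mw' (pair1_measurable _)).
- by move=> t e e0; rewrite -dilate_cons; exact: uw.
Qed.

End IidLaw.

(** * Sets disjoint from their dilations *)

Section DisjointDilate.
Context {R : realType}.
Local Open Scope ereal_scope.

Lemma measurable_dilate n (c : R) : measurable_fun setT (@dilate R n c).
Proof.
apply/measurable_fun_tnthP => i.
rewrite (_ : _ \o _ = fun x : n.-tuple R => c * tnth x i)%R; last first.
  by apply/funext => x /=; rewrite tnth_mktuple.
by apply: measurable_funM => //; exact: measurable_tnth.
Qed.

(** If [Q A > 15/16], then both the complement of [A] and the preimage of [A] under
    the dilation have mass below 1/16. Put [u = 1/4 + 4 * 1_(~` A)] and
    [w = 1/4 + 4 * 1_(c^-1 A)]. Then [u (c t) * w t >= 1] for all [t], while the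
    sum of the integrals of [u] and [w] is less than 1, below the value
    [2 * rho ^+ n >= 3/2] required by [affinity_tensor]. *)
Lemma iid_law_disjoint_dilate (mu : probability R R) (p : R -> R) (c rho : R)
    n (Q : probability (n.-tuple R) R) (A : set (n.-tuple R)) :
  measurable_fun setT p -> (forall x, 0 <= p x)%R ->
  (forall A, measurable A ->
     mu A = \int[@lebesgue_measure R]_(x in A) (p x)%:E) ->
  (0 < c)%R -> (0 <= rho)%R -> rho%:E <= affinity p c ->
  (3 / 4 <= rho ^+ n)%R -> iid_law mu Q -> measurable A ->
  (forall x, A x -> ~ A (dilate c x)) -> Q A <= (1 - 16^-1)%:E.
Proof.
move=> mp p0 muE c0 rho0 rhoc rhon Qmu mA disj.
pose A' := dilate c @^-1` A.
have mA' : measurable A'.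
  by rewrite -[A']setTI; exact: measurable_dilate.
have A'A : Q A' <= Q (~` A).
  by rewrite le_measure ?inE//; [exact: measurableC|move=> x A'x Ax; exact: (disj x)].
pose ind (B : set (n.-tuple R)) t : \bar R := (4^-1 + 4 * \1_B t)%:E.
have ind0 B t : 0 <= ind B t by rewrite lee_fin addr_ge0 ?mulr_ge0.
have mind B : measurable B -> measurable_fun setT (ind B).
  move=> mB; apply/measurable_EFinP/measurable_funD => //.
  exact: measurable_funM.
have int_ind B : measurable B -> \int[Q]_t ind B t = 4^-1%:E + 4%:E * Q B.
  move=> mB; rewrite /ind; under eq_integral do rewrite EFinD EFinM.
  rewrite ge0_integralD; last 5 first.
  - by [].
  - by move=> t _; rewrite lee_fin.
  - exact/measurable_EFinP.
  - by move=> t _; rewrite mule_ge0// lee_fin.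
  - exact/measurable_funeM/measurable_EFinP.
  rewrite integral_cst//= ge0_integralZl_EFin//; last exact/measurable_EFinP.
  by rewrite integral_indic// setIT [X in _ * X + _]probability_setT mule1.
have := @affinity_tensor R mu p c rho mp p0 muE c0 rho0 rhoc n Q Qmu 1%R
  (ind (~` A)) (ind A') ler01 (mind _ (measurableC mA)) (ind0 _) (mind _ mA') (ind0 _).
have uw t (a : R) : (0 < a)%R ->
    (2 * 1)%:E <= a%:E * ind (~` A) (dilate c t) + a^-1%:E * ind A' t.
  move=> a0; rewrite /ind -!EFinM -EFinD lee_fin !indicE.
  have aV : (0 < a^-1)%R by rewrite invr_gt0.
  have [At|At] := pselect (A (dilate c t)).
    have -> : (dilate c t \in ~` A) = false by apply/negbTE; rewrite notin_setE/=; exact.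
    have -> : (t \in A') by rewrite inE.
    rewrite /= !mulr1 mulr0 addr0.
    have := mulr_ge0 (ltW aV) (sqr_ge0 (a / 2 - 2)%R).
    have -> : (a^-1 * (a / 2 - 2) ^+ 2 = a / 4 + 4 * a^-1 - 2)%R.
      by field; rewrite gt_eqF.
    lra.
  have -> : dilate c t \in ~` A by rewrite inE.
  have -> : (t \in A') = false by apply/negbTE; rewrite notin_setE.
  rewrite /= !mulr1 mulr0 addr0.
  have := mulr_ge0 (ltW aV) (sqr_ge0 (2 * a - 2^-1)%R).
  have -> : (a^-1 * (2 * a - 2^-1) ^+ 2 = 4 * a + a^-1 / 4 - 2)%R.
    by field; rewrite gt_eqF.
  lra.
move=> /(_ uw 1%R ltr01).
rewrite invr1 !mul1e !int_ind//; last exact: measurableC.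
have : Q A = 1 - Q (~` A) by rewrite -[A in LHS]setCK probability_setC//; exact: measurableC.
have : 0 <= Q A' by [].
move: A'A; rewrite -[Q A']fineK ?fin_num_measure// -[Q (~` A)]fineK; last first.
  by rewrite fin_num_measure//; exact: measurableC.
move=> + _ ->.
rewrite -EFinB -!EFinM -!EFinD !lee_fin; nra.
Qed.

End DisjointDilate.

(** * The law of the sample *)

Section JointLaw.
Context d (T : measurableType d) (R : realType) (P : probability T R).
Variable X : nat -> {RV P >-> R}.
Local Open Scope ereal_scope.

Definition sample n (w : T) : n.-tuple R := [tuple X i w | i < n].

Lemma measurable_sample n : measurable_fun setT (@sample n).
Proof.
apply/measurable_fun_tnthP => i.
rewrite (_ : _ \o _ = (X i : T -> R))//.
by apply/funext => w /=; rewrite tnth_mktuple.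
Qed.

HB.instance Definition _ n := isMeasurableFun.Build _ _ _ _ (@sample n)
  (@measurable_sample n).

Lemma sample_iid_law (p : R -> R) n :
  mutually_independent X -> (forall i, has_density (X i) p) ->
  iid_law (distribution P (X 0%N)) (distribution P (@sample n)).
Proof.
move=> indep dens A mA.
(* Independence is stated for sets indexed by all integers; those beyond [n] are
   taken to be the whole line. *)
pose A' j := oapp A setT (insub j : option 'I_n).
have mA' j : measurable (A' j).
  by rewrite /A'; case: insubP => [i _ _|_] //=.
have A'E (i : 'I_n) : A' i = A i by rewrite /A' valK.
pose J : {fset nat} := [fset j | j in iota 0 n]%fset.
have JE j : (j \in J) = (j < n)%N.
  by rewrite in_fset/= mem_iota.
have sampleE : @sample n @^-1` box A = \bigcap_(i in [set` J]) (X i @^-1` A' i).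
  apply/seteqP; split => [w At j /=|w At i].
    by rewrite JE => jn; have := At (Ordinal jn); rewrite tnth_mktuple -A'E.
  by rewrite tnth_mktuple -A'E; apply: At; rewrite /= JE.
transitivity (P (\bigcap_(i in [set` J]) (X i @^-1` A' i))).
  by rewrite -sampleE.
rewrite indep// (perm_big (index_iota 0 n)); last first.
  apply: uniq_perm => [||j]; rewrite ?fset_uniq ?iota_uniq//.
  by rewrite JE mem_index_iota.
rewrite big_mkord; apply: eq_bigr => i _; rewrite A'E.
by apply: (eq_trans (dens _ _ (mA i))); apply/esym/dens.
Qed.

End JointLaw.

(** * Logarithms of determinants *)

Section Determinant.
Context {R : realType}.

Lemma det_continuous N : continuous (fun M : 'M[R]_N => \det M).
Proof.
have addc : continuous (fun z : R * R => z.1 + z.2).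
  by move=> z; apply: cvgD; [exact: cvg_fst|exact: cvg_snd].
have mulc : continuous (fun z : R * R => z.1 * z.2).
  by move=> z; apply: cvgM; [exact: cvg_fst|exact: cvg_snd].
apply: (continuous_big addc) => s _ M.
apply: (@continuousM _ _ (fun=> (-1) ^+ s)
          (fun A : 'M[R]_N => \prod_i A i (s i))).
  exact: cst_continuous.
move: M.
by apply: (continuous_big mulc) => i _; exact: coord_continuous.
Qed.

(** For real bounds the value [-oo] taken at [x = 0] never lies between them. *)
Lemma lne_itv (a b x : R) : 0 <= x ->
  (a%:E <= lne x%:E <= b%:E)%E = (expR a <= x <= expR b).
Proof.
rewrite le_eqVlt => /predU1P[<-|x0].
  by rewrite /lne lexx leeNy_eq/= leNgt expR_gt0.
rewrite lne_EFin// !lee_fin -[x in RHS](@lnK R)//.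
by rewrite !ler_expR.
Qed.

Lemma measurable_log_det_itv d (T : measurableType d) N (f : T -> 'M[R]_N)
    (a b : R) : borel_measurable_mx f ->
  measurable [set t | (a%:E <= lne (`|\det (f t)|)%:E <= b%:E)%E].
Proof.
move=> mf.
pose C : set 'M[R]_N := (fun M => `|\det M|) @^-1` `[expR a, expR b].
have -> : [set t | (a%:E <= lne (`|\det (f t)|)%:E <= b%:E)%E] = f @^-1` C.
  by apply/seteqP; split => t /=; rewrite /C/= lne_itv// in_itv.
rewrite -[_ @^-1` _]setTI; apply: mf => //.
rewrite -[C]setCK; apply: measurableC; apply: sub_sigma_algebra.
apply: closed_openC; apply: closed_comp; last exact: itv_closed.
move=> M _; apply: (@continuous_comp _ _ _ (fun A : 'M[R]_N => \det A)).
  exact: det_continuous.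
exact: norm_continuous.
Qed.

End Determinant.

(** * Fluctuations *)

Lemma exprB1_ge (R : realFieldType) (x : R) n :
  0 <= x <= 1 -> 1 - n%:R * x <= (1 - x) ^+ n.
Proof.
move=> /andP[x0 x1]; elim: n => [|n IH]; first by rewrite mul0r subr0.
rewrite exprS.
have : (1 - x) * (1 - n%:R * x) <= (1 - x) * (1 - x) ^+ n.
  by rewrite ler_wpM2l// subr_ge0.
have : 0 <= n%:R * x * x by rewrite !mulr_ge0.
by rewrite -natr1; nra.
Qed.

Theorem theorem2p10 (R : realType) (d : measure_display)
    (T : measurableType d) (P : probability T R)
    (X : nat -> {RV P >-> R}) (p : R -> R)
    (hp : densityP1 p \/ densityP1plus p)
    (X_indep : mutually_independent X)
    (X_density : forall i, has_density (X i) p)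
    (r : R) (r_gt0 : 0 < r)
    (N : nat -> nat) (N_gt0 : forall n, (0 < n)%N -> (0 < N n)%N)
    (f : forall n, n.-tuple R -> 'M[R]_(N n))
    (f_meas : forall n, (0 < n)%N -> borel_measurable_mx (@f n))
    (f_homog : forall n, (0 < n)%N -> forall (x : n.-tuple R) (lambda : R),
       0 <= lambda ->
       f n [tuple lambda * tnth x i | i < n] = lambda `^ r *: f n x) :
  let M (n : nat) (w : T) : 'M[R]_(N n) := f n [tuple X i w | i < n] in
  fluctuations_at_least P
    (fun n w => lne (`|\det (M n w)|)%:E)
    (fun n => n%:R `^ (- 2^-1) * (N n)%:R).
Proof.
move=> M.
have [mp p0 p1 [B lip]] := density_facts hp.
pose K := B ^+ 2 * pi / 2.
have K0 : 0 <= K by rewrite divr_ge0// mulr_ge0 ?sqr_ge0 ?pi_ge0.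
(* Small enough for [K * eta^2 <= 1/4], so that [(1 - K eta^2 / n)^n >= 3/4]. *)
pose eta := (2 * (1 + K))^-1.
have eta0 : 0 < eta by rewrite invr_gt0; lra.
have eta1 : eta <= 1 by rewrite invf_le1; lra.
have Keta : K * eta ^+ 2 <= 4^-1.
  have -> : K * eta ^+ 2 = 4^-1 * (K / (1 + K) ^+ 2).
    by rewrite /eta; field; lra.
  rewrite ler_piMr// ler_pdivrMr ?mul1r; last by rewrite exprn_gt0//; lra.
  by rewrite expr2; nra.
(* The shift [r N_n ln c] is at least [r (eta / 2) n^(-1/2) N_n], twice the length
   allowed for the interval. *)
exists (r * eta / 4), 16^-1; split => //.
  by rewrite !mulr_gt0.
exists 1%N => // n /= n_gt0 a b ab abn.
have n0 : (0 : R) < n%:R by rewrite ltr0n.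
pose delta : R := n%:R `^ (- 2^-1).
have delta0 : 0 < delta by exact: powR_gt0.
have delta2 : delta ^+ 2 = n%:R^-1.
  by rewrite /delta powRN exprVn powR12_sqrt ?ltW// sqr_sqrtr ?ltW.
have delta1 : delta <= 1.
  by rewrite -(@expr_le1 _ 2)// ?delta2 ?invf_le1 ?ler1n// ltW.
pose c := 1 + eta * delta.
have ed0 : 0 < eta * delta by exact: mulr_gt0.
have c1 : 1 <= c by rewrite /c; lra.
have c0 : 0 < c by lra.
pose rho := 1 - K * (c - 1) ^+ 2.
have rhoE : K * (c - 1) ^+ 2 = K * eta ^+ 2 / n%:R.
  by rewrite /c -delta2; ring.
have Kn0 : 0 <= K * eta ^+ 2 / n%:R.
  by rewrite divr_ge0 ?(ltW n0)// mulr_ge0// sqr_ge0.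
have Kn1 : K * eta ^+ 2 / n%:R <= 1.
  rewrite ler_pdivrMr// mul1r; have : (1 : R) <= n%:R by rewrite ler1n.
  by lra.
have rho0 : 0 <= rho by rewrite /rho rhoE; lra.
have rhon : 3 / 4 <= rho ^+ n.
  rewrite /rho rhoE; apply: le_trans (exprB1_ge n _); last by rewrite Kn0.
  rewrite mulrCA mulfV ?gt_eqF// mulr1; lra.
have rhoc : (rho%:E <= affinity p c)%E.
  by apply: affinity_ge => // x; exact: lip.
have Siid : iid_law (distribution P (X 0%N)) (distribution P (sample X n)).
  exact: sample_iid_law X_density.
have := iid_law_disjoint_dilate mp p0 (X_density 0%N) c0 rho0 rhoc rhon Siid
  (measurable_log_det_itv a b (f_meas n n_gt0)).
apply => x /=; rewrite !lne_itv// => /andP[ax xb].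
rewrite /dilate f_homog ?(ltW c0)// detZ normrM.
have dx0 : 0 < `|\det (f n x)| by rewrite (lt_le_trans _ ax)// expR_gt0.
set y := `|\det (f n x)| in ax xb dx0 *.
have -> : `|(c `^ r) ^+ N n| = expR ((N n)%:R * (r * ln c)).
  by rewrite ger0_norm ?exprn_ge0 ?powR_ge0// expRM_natl /powR gt_eqF.
move=> /andP[_].
rewrite -[y](@lnK R)// -expRD ler_expR => cyb.
have ay : a <= ln y by rewrite -ler_expR lnK.
have lnc : eta * delta / 2 <= ln c.
  have := @le_ln1Dx R (c^-1 - 1).
  rewrite addrCA subrr addr0 lnV ?posrE// ltrBrDl subrr invr_gt0 c0 => /(_ isT).
  have : c^-1 <= 1 - eta * delta / 2.
    rewrite -(ler_pM2l c0) mulfV ?gt_eqF// /c.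
    have ed1 : eta * delta <= 1.
      by rewrite mulr_ile1 ?(ltW eta0) ?(ltW delta0).
    by nra.
  lra.
have N0 : (0 : R) < (N n)%:R by rewrite ltr0n N_gt0.
rewrite -/delta in abn.
have : (N n)%:R * (r * (eta * delta / 2)) <= (N n)%:R * (r * ln c).
  by rewrite !ler_wpM2l// ltW.
have : 0 < (N n)%:R * (r * (eta * delta)) by rewrite !mulr_gt0.
move: abn; rewrite (_ : r * eta / 4 * _ = (N n)%:R * (r * (eta * delta)) / 4).
  by lra.
by ring.
Qed.
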